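(* Every element of $\mathrm{SL}(3,\mathbb{H})$ can be written as a product of four simple elements of $\mathrm{SL}(3,\mathbb{H})$.
   Context: $\mathbb{H}$ denotes Hamilton's real quaternions. For $A\in \mathrm{M}(3,\mathbb{H})$ write $A=A_1+A_2\mathbf{j}$ with $A_1,A_2\in \mathrm{M}(3,\mathbb{C})$, and put $\det_{\mathbb{H}}(A):=\det\begin{pmatrix} A_1 & A_2\\ -\overline{A_2} & \overline{A_1}\end{pmatrix}$. Put $\mathrm{SL}(3,\mathbb{H})=\{g\in \mathrm{M}(3,\mathbb{H}) : \det_{\mathbb{H}}(g)=1\}$. The group $\mathrm{SL}(3,\mathbb{R})$ of real $3\times 3$ matrices of determinant $1$ is regarded as a subgroup of $\mathrm{SL}(3,\mathbb{H})$. An element $g\in \mathrm{SL}(3,\mathbb{H})$ is called simple if it is conjugate (in $\mathrm{SL}(3,\mathbb{H})$) to an element of $\mathrm{SL}(3,\mathbb{R})$. *)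

(* Defs.v *)
From HB Require Import structures.
From mathcomp Require Import all_boot all_order all_algebra.
From mathcomp Require Import reals.
From mathcomp Require Import complex ring.

Set Implicit Arguments.
Unset Strict Implicit.
Unset Printing Implicit Defensive.

Import GRing.Theory Num.Theory.

Local Open Scope ring_scope.

(* Hamilton's quaternions over the reals R: [Quat a b] with a b : R[i] stands
   for a + b j, where j ^ 2 = - 1 and j a = a^* j. *)
Record quat (R : realType) : Type := Quat { quat_fst : R[i]; quat_snd : R[i] }.

Section QuatRing.
Variable R : realType.
Local Notation H := (quat R).
Implicit Types x y z : H.

Definition pair_of_quat x := (quat_fst x, quat_snd x).
Definition quat_of_pair (u : R[i] * R[i]) : H := Quat u.1 u.2.

Lemma pair_of_quatK : cancel pair_of_quat quat_of_pair.
Proof. by case. Qed.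

HB.instance Definition _ := Equality.copy H (can_type pair_of_quatK).
HB.instance Definition _ := Choice.copy H (can_type pair_of_quatK).

Definition quat0 : H := Quat 0 0.
Definition quat1 : H := Quat 1 0.
Definition quat_opp x : H := Quat (- quat_fst x) (- quat_snd x).
Definition quat_add x y : H :=
  Quat (quat_fst x + quat_fst y) (quat_snd x + quat_snd y).

(* (a + b j) (c + d j) = (a c - b d^* ) + (a d + b c^* ) j *)
Definition quat_mul x y : H :=
  Quat (quat_fst x * quat_fst y - quat_snd x * (quat_snd y)^*)
       (quat_fst x * quat_snd y + quat_snd x * (quat_fst y)^*).

Lemma quat_addA : associative quat_add.
Proof. by move=> x y z; rewrite /quat_add /= !addrA. Qed.

Lemma quat_addC : commutative quat_add.
Proof. by move=> x y; rewrite /quat_add addrC [_ + quat_snd y]addrC. Qed.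

Lemma quat_add0l : left_id quat0 quat_add.
Proof. by case=> a b; rewrite /quat_add /= !add0r. Qed.

Lemma quat_addNl : left_inverse quat0 quat_opp quat_add.
Proof. by move=> x; rewrite /quat_add /= !addNr. Qed.

HB.instance Definition _ :=
  GRing.isZmodule.Build H quat_addA quat_addC quat_add0l quat_addNl.

Lemma quat_mulA : associative quat_mul.
Proof.
move=> [a b] [c d] [e f]; rewrite /quat_mul /= !(rmorphB, rmorphD, rmorphM) /=.
by congr Quat; rewrite ?conjCK; ring.
Qed.

Lemma quat_mul1l : left_id quat1 quat_mul.
Proof. by case=> a b; rewrite /quat_mul /= !mul1r !mul0r subr0 addr0. Qed.

Lemma quat_mul1r : right_id quat1 quat_mul.
Proof.
by case=> a b; rewrite /quat_mul /= rmorph0 rmorph1 !mulr0 !mulr1 subr0 add0r.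
Qed.

Lemma quat_mulDl : left_distributive quat_mul quat_add.
Proof. by move=> x y z; rewrite /quat_mul /quat_add /=; congr Quat; ring. Qed.

Lemma quat_mulDr : right_distributive quat_mul quat_add.
Proof.
by move=> x y z; rewrite /quat_mul /quat_add /= !raddfD /=; congr Quat; ring.
Qed.

Lemma quat1_neq0 : quat1 != quat0.
Proof. by apply/eqP => -[/eqP]; rewrite oner_eq0. Qed.

HB.instance Definition _ :=
  GRing.Zmodule_isNzRing.Build H quat_mulA quat_mul1l quat_mul1r
    quat_mulDl quat_mulDr quat1_neq0.

Definition quat_i : H := Quat 'i%C 0.
Definition quat_j : H := Quat 0 1.
Definition quat_k : H := Quat 0 'i%C.
Definition quatC (z : R[i]) : H := Quat z 0.
Definition quatR (r : R) : H := quatC r%:C%C.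

Lemma quatE x : x = quatC (quat_fst x) + quatC (quat_snd x) * quat_j.
Proof.
case: x => a b.
by congr Quat; rewrite /= ?rmorph0 ?rmorph1; ring.
Qed.

Lemma quat_hamilton :
  [/\ quat_i * quat_i = -1, quat_j * quat_j = -1, quat_k * quat_k = -1
    & quat_i * quat_j * quat_k = -1].
Proof.
by split; congr Quat; rewrite /=; apply/eqP; rewrite eq_complex /=; apply/andP;
  split; apply/eqP; ring.
Qed.

End QuatRing.

Arguments quatC {R} z.
Arguments quatR {R} r.

Section QuatMatrix.
Variable R : realType.
Variable n : nat.
Local Notation H := (quat R).

(* The matrices A1 and A2 of the decomposition A = A1 + A2 j. *)
Definition mxfst (A : 'M[H]_n) : 'M[R[i]]_n := map_mx (@quat_fst R) A.
Definition mxsnd (A : 'M[H]_n) : 'M[R[i]]_n := map_mx (@quat_snd R) A.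

Lemma mx_quatE (A : 'M[H]_n) :
  A = map_mx quatC (mxfst A) + map_mx quatC (mxsnd A) *m (quat_j R)%:M.
Proof.
apply/matrixP => i j; rewrite !mxE (bigD1 j) //= big1 ?addr0.
  by rewrite !mxE eqxx mulr1n; exact: quatE.
by move=> k /negPf kj; rewrite !mxE kj mulr0.
Qed.

Definition detH (A : 'M[H]_n) : R[i] :=
  \det (block_mx (mxfst A) (mxsnd A)
                 (- map_mx Num.conj (mxsnd A)) (map_mx Num.conj (mxfst A))).

Definition SLH (A : 'M[H]_n) : Prop := detH A = 1.

(* [hinv] is the inverse of [h]; explicit because MathComp's [invmx] is
   restricted to commutative coefficient rings. *)
Definition conjugate_SLH (g s : 'M[H]_n) : Prop :=
  exists h hinv : 'M[H]_n,
    [/\ SLH h, SLH hinv, h *m hinv = 1%:M, hinv *m h = 1%:M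
      & g = h *m s *m hinv].

Definition simple_SLH (g : 'M[H]_n) : Prop :=
  SLH g /\ exists2 s : 'M[R]_n, \det s = 1 & conjugate_SLH g (map_mx quatR s).

End QuatMatrix.

(* Main.v *)
Require Import Defs.
From HB Require Import structures.
From mathcomp Require Import all_boot all_order all_algebra.
From mathcomp Require Import reals complex ring lra.

(* By conjugations with elementary matrices one can make the successive pivots
   of g real, except the last one; hence g is conjugate to L diag(a, b, d') U
   with a, b real and nonzero and L, U unitriangular.  A triangular matrix whose
   diagonal entries are distinct reals is diagonalizable, hence simple when their
   product is 1; so L diag(p) and diag(q) U are simple for suitable real p, q,
   and diag(1, 1, d) remains in the middle, where |d| = 1 by comparing
   determinants.  A unit quaternion is a product of two square roots x, y of -1,
   so diag(1, 1, d) = diag(1, y^-1, x) diag(1, y, y), and both factors are simple: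
   square roots of -1 on the diagonal are conjugate to a real quarter turn. *)

Set Implicit Arguments.
Unset Strict Implicit.
Unset Printing Implicit Defensive.

Import Order.TTheory GRing.Theory Num.Theory.

Local Open Scope ring_scope.

(** * Quaternions: centre, norm, inverses and square roots of -1 *)

Section Quaternions.
Variable R : realType.
Local Notation H := (quat R).
Implicit Types (x y q : H) (r : R).

Lemma quat_fst_is_zmod_morphism : zmod_morphism (@quat_fst R).
Proof. by case=> a b [c d]. Qed.
HB.instance Definition _ :=
  GRing.isZmodMorphism.Build H R[i] (@quat_fst R) quat_fst_is_zmod_morphism.

Lemma quat_snd_is_zmod_morphism : zmod_morphism (@quat_snd R).
Proof. by case=> a b [c d]. Qed.
HB.instance Definition _ :=
  GRing.isZmodMorphism.Build H R[i] (@quat_snd R) quat_snd_is_zmod_morphism.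

Lemma quatC_is_zmod_morphism : zmod_morphism (@quatC R).
Proof. by move=> a b; congr Quat; rewrite /= subr0. Qed.
HB.instance Definition _ :=
  GRing.isZmodMorphism.Build R[i] H (@quatC R) quatC_is_zmod_morphism.

Lemma quatC_is_monoid_morphism : monoid_morphism (@quatC R).
Proof.
by split=> // a b; congr Quat; rewrite /= ?rmorph0 ?mulr0 ?mul0r ?subr0 ?addr0.
Qed.
HB.instance Definition _ :=
  GRing.isMonoidMorphism.Build R[i] H (@quatC R) quatC_is_monoid_morphism.

HB.instance Definition _ := GRing.RMorphism.copy (@quatR R)
  (@quatC R \o real_complex R).

Lemma quatR_comm r x : quatR r * x = x * quatR r.
Proof.
case: x => -[a0 a1] [b0 b1]; congr Quat; apply/eqP; rewrite eq_complex /=;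
  by apply/andP; split; apply/eqP; ring.
Qed.

(** Commuting with i kills the j and k components, and commuting with j kills the i component. *)
Lemma quatR_centralE x :
  x * quat_i R = quat_i R * x -> x * quat_j R = quat_j R * x ->
  x = quatR (complex.Re (quat_fst x)).
Proof.
case: x => -[a0 a1] [b0 b1] [] e1 e2 e3 e4 [] f1 f2 f3 f4.
by congr Quat; apply/eqP; rewrite eq_complex /=;
  apply/andP; split; apply/eqP; lra.
Qed.

(* The Sylvester operator q |-> y q - q x vanishes only if x = y is central. *)
Lemma sylvester_neq0 x y : (forall r, x != quatR r) ->
  exists q, y * q - q * x != 0.
Proof.
move=> xNR; have [->|yNx] := eqVneq y x; last first.
  by exists 1; rewrite mulr1 mul1r subr_eq0.
have [xi|] := eqVneq (x * quat_i R) (quat_i R * x); last first.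
  by rewrite -subr_eq0; exists (quat_i R).
have [xj|] := eqVneq (x * quat_j R) (quat_j R * x); last first.
  by rewrite -subr_eq0; exists (quat_j R).
by have /eqP := xNR (complex.Re (quat_fst x)); rewrite -quatR_centralE.
Qed.

Definition qconj x : H := Quat (quat_fst x)^* (- quat_snd x).

Definition qnorm x : R :=
  let: Quat (a0 +i* a1)%C (b0 +i* b1)%C := x in
  a0 ^+ 2 + a1 ^+ 2 + b0 ^+ 2 + b1 ^+ 2.

Lemma qconj_is_zmod_morphism : zmod_morphism qconj.
Proof. by move=> x y; congr Quat; rewrite /= ?rmorphB ?opprD. Qed.
HB.instance Definition _ :=
  GRing.isZmodMorphism.Build H H qconj qconj_is_zmod_morphism.

Lemma qconjK : involutive qconj.
Proof. by case=> a b; rewrite /qconj /= conjCK opprK. Qed.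

Lemma qconjM x y : qconj (x * y) = qconj y * qconj x.
Proof.
case: x y => a b [c d]; rewrite /qconj /=; congr Quat => /=.
  by rewrite !rmorphB /= !rmorphM /= !conjCK rmorphN /=; ring.
by rewrite !conjCK; ring.
Qed.

Lemma qconjR r : qconj (quatR r) = quatR r.
Proof. by congr Quat; rewrite /= ?oppr0 //; apply: conjc_real. Qed.

Lemma mulq_conj x : x * qconj x = quatR (qnorm x).
Proof.
case: x => -[a0 a1] [b0 b1]; congr Quat; apply/eqP; rewrite eq_complex /=;
  by apply/andP; split; apply/eqP; ring.
Qed.

Lemma mulq_conjl x : qconj x * x = quatR (qnorm x).
Proof.
case: x => -[a0 a1] [b0 b1]; congr Quat; apply/eqP; rewrite eq_complex /=;
  by apply/andP; split; apply/eqP; ring.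
Qed.

Lemma qnormM x y : qnorm (x * y) = qnorm x * qnorm y.
Proof. by case: x y => -[a0 a1] [b0 b1] [[c0 c1] [d0 d1]] /=; ring. Qed.

Lemma qnormR r : qnorm (quatR r) = r ^+ 2.
Proof. by rewrite /=; ring. Qed.

Lemma qnorm_ge0 x : 0 <= qnorm x.
Proof. by case: x => -[a0 a1] [b0 b1] /=; rewrite !addr_ge0 ?sqr_ge0. Qed.

Lemma qnorm_eq0 x : (qnorm x == 0) = (x == 0).
Proof.
apply/eqP/eqP => [|->]; last by rewrite /=; ring.
case: x => -[a0 a1] [b0 b1] /= n0.
have sq0 (z : R) : z ^+ 2 <= 0 -> z = 0.
  by move=> zle0; apply/eqP; rewrite -sqrf_eq0 eq_le zle0 sqr_ge0.
have [? ? ? ?]: [/\ 0 <= a0 ^+ 2, 0 <= a1 ^+ 2, 0 <= b0 ^+ 2 & 0 <= b1 ^+ 2].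
  by rewrite !sqr_ge0.
by rewrite (sq0 a0) 1?(sq0 a1) 1?(sq0 b0) 1?(sq0 b1) //; lra.
Qed.

Lemma quat_inverse x : x != 0 -> exists2 y, x * y = 1 & y * x = 1.
Proof.
rewrite -qnorm_eq0 => nx0; exists (quatR (qnorm x)^-1 * qconj x).
  by rewrite quatR_comm mulrA mulq_conj -rmorphM mulfV ?rmorph1.
by rewrite -mulrA mulq_conjl -rmorphM mulVf ?rmorph1.
Qed.

Lemma quat_polar x : x != 0 ->
  exists r e, [/\ r != 0, qnorm e = 1 & x = quatR r * e].
Proof.
move=> x0; have r0 : Num.sqrt (qnorm x) != 0.
  by rewrite sqrtr_eq0 -ltNge lt_def qnorm_eq0 x0 qnorm_ge0.
exists (Num.sqrt (qnorm x)), (quatR (Num.sqrt (qnorm x))^-1 * x); split=> //.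
  rewrite qnormM qnormR exprVn sqr_sqrtr ?qnorm_ge0 // mulVf //.
  by rewrite qnorm_eq0.
by rewrite mulrA -rmorphM mulfV // rmorph1 mul1r.
Qed.

Lemma sqr_pure x : qnorm x = 1 -> qconj x = - x -> x * x = -1.
Proof.
by move=> nx cx; rewrite -[LHS]opprK -mulrN -cx mulq_conj nx rmorph1.
Qed.

(** Since u^-1 = - u, this writes x = (x u)(- u) as a product of two square roots of -1. A pure unit
    quaternion squares to -1, and x u is pure as soon as u is pure and orthogonal to the imaginary
    part of x. *)
Lemma unit_quat_factor x : qnorm x = 1 ->
  exists2 u, u * u = -1 & (x * u) * (x * u) = -1.
Proof.
case: x => -[a0 a1] [b0 b1] n1.
(* [u] is a unit of the plane spanned by j and k, orthogonal to [b0 j + b1 k]. *)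
have [z0 [z1 [nz bz]]] :
    exists z0 z1 : R, z0 ^+ 2 + z1 ^+ 2 = 1 /\ b0 * z0 + b1 * z1 = 0.
  have [nb0|nb0] := eqVneq (b0 ^+ 2 + b1 ^+ 2) 0.
    move/eqP: nb0; rewrite paddr_eq0 ?sqr_ge0 // !sqrf_eq0.
    by move=> /andP[/eqP-> /eqP->]; exists 1, 0; split; ring.
  pose n := Num.sqrt (b0 ^+ 2 + b1 ^+ 2).
  have n2 : n ^+ 2 = b0 ^+ 2 + b1 ^+ 2 by rewrite sqr_sqrtr ?addr_ge0 ?sqr_ge0.
  have n0 : n != 0 by rewrite -sqrf_eq0 n2.
  exists (- b1 / n), (b0 / n); split; last by field.
  have -> : (- b1 / n) ^+ 2 + (b0 / n) ^+ 2 = (b0 ^+ 2 + b1 ^+ 2) / n ^+ 2.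
    by field.
  by rewrite n2 mulfV.
pose u : H := Quat 0 (z0 +i* z1)%C.
have nu : qnorm u = 1 by rewrite /= -[RHS]nz; ring.
exists u; apply: sqr_pure => //.
- by congr Quat; rewrite /= ?rmorph0 ?oppr0.
- by rewrite qnormM n1 nu mulr1.
(* The real part of x u is - (b0 z0 + b1 z1), which vanishes by [bz]. *)
congr Quat; apply/eqP; rewrite eq_complex /=;
  by apply/andP; split; apply/eqP; lra.
Qed.

End Quaternions.

(** * The quaternionic determinant and conjugation in SL(n, H) *)

Section QuaternionicDeterminant.
Variables (R : realType) (n : nat).
Local Notation H := (quat R).
Implicit Types A B P Q : 'M[H]_n.

(** The standard complex representation of quaternionic matrices. Its determinant is [detH], so the
    multiplicativity of [detH] comes from that of [mxC]. *)
Definition mxC A : 'M[R[i]]_(n + n) :=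
  block_mx (mxfst A) (mxsnd A)
           (- map_mx Num.conj (mxsnd A)) (map_mx Num.conj (mxfst A)).

Lemma mxfstM A B :
  mxfst (A *m B) = mxfst A *m mxfst B - mxsnd A *m map_mx Num.conj (mxsnd B).
Proof.
apply/matrixP=> i j; rewrite !mxE raddf_sum /= -sumrB.
by apply: eq_bigr => k _; rewrite !mxE.
Qed.

Lemma mxsndM A B :
  mxsnd (A *m B) = mxfst A *m mxsnd B + mxsnd A *m map_mx Num.conj (mxfst B).
Proof.
apply/matrixP=> i j; rewrite !mxE raddf_sum /= -big_split.
by apply: eq_bigr => k _; rewrite !mxE.
Qed.

Lemma map_conjK (C : 'M[R[i]]_n) : map_mx Num.conj (map_mx Num.conj C) = C.
Proof. by apply/matrixP=> i j; rewrite !mxE conjCK. Qed.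

Lemma mxCM A B : mxC (A *m B) = mxC A *m mxC B.
Proof.
rewrite /mxC mulmx_block !mxfstM !mxsndM.
rewrite !(map_mxB, map_mxD, map_mxM, map_mxN, map_conjK) /=.
rewrite !mulmxN !mulNmx.
by congr block_mx; rewrite ?opprD 1?[LHS]addrC //.
Qed.

Lemma mxC1 : mxC 1%:M = 1%:M.
Proof.
rewrite scalar_mx_block /mxC; congr block_mx; apply/matrixP=> i j; rewrite !mxE;
  by case: eqP => _; rewrite ?mulr1n ?mulr0n /= ?rmorph0 ?rmorph1 ?oppr0.
Qed.

Lemma mxC0 : mxC 0 = 0.
Proof.
rewrite -block_mx0 /mxC; congr block_mx; apply/matrixP=> i j; rewrite !mxE /=;
  by rewrite ?rmorph0 ?oppr0.
Qed.

Lemma mxC_eq0 A : mxC A = 0 -> A = 0.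
Proof.
rewrite -block_mx0 => /eq_block_mx[/matrixP A1 /matrixP A2 _ _].
apply/matrixP=> i j; move: (A1 i j) (A2 i j); rewrite !mxE.
by case: (A i j) => a b /= -> ->.
Qed.

Lemma detHM A B : detH (A *m B) = detH A * detH B.
Proof. by rewrite /detH -!/(mxC _) mxCM det_mulmx. Qed.

Lemma detH1 : detH (1%:M : 'M[H]_n) = 1.
Proof. by rewrite /detH -/(mxC _) mxC1 det1. Qed.

(** The complex representation of a real matrix is block diagonal with two copies of it, whence the
    square. *)
Lemma detH_quatR (A : 'M[R]_n) :
  detH (map_mx quatR A) = real_complex R (\det A ^+ 2).
Proof.
have -> : detH (map_mx quatR A) =
    \det (block_mx (map_mx (real_complex R) A) 0 0 (map_mx (real_complex R) A)).
  congr (\det (block_mx _ _ _ _)); apply/matrixP=> i j; rewrite !mxE //= ?oppr0 //.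
    by rewrite rmorph0 oppr0.
  exact: conjc_real.
by rewrite det_ublock det_map_mx -rmorphM expr2.
Qed.

(** Invertibility is tested on [mxC A], over a field. Left cancellation is the form of it that
    passes to Schur complements in [conj_LDU]. *)
Lemma SLH_regular A : SLH A -> forall X : 'M[H]_n, A *m X = 0 -> X = 0.
Proof.
move=> sA X AX0; apply: mxC_eq0.
have uA : mxC A \in unitmx by rewrite unitmxE -/(detH A) sA unitr1.
by rewrite -[mxC X](mulKmx uA) -mxCM AX0 mxC0 mulmx0.
Qed.

Lemma SLH1 : SLH (1%:M : 'M[H]_n).
Proof. exact: detH1. Qed.

Lemma SLHM A B : SLH A -> SLH B -> SLH (A *m B).
Proof. by rewrite /SLH detHM => -> ->; rewrite mul1r. Qed.

Lemma SLHV A B : SLH A -> A *m B = 1%:M -> SLH B.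
Proof.
by rewrite /SLH => sA /(congr1 (@detH _ _)); rewrite detHM sA detH1 mul1r.
Qed.

Lemma SLH_conj A P Q : P *m Q = 1%:M -> SLH (P *m A *m Q) <-> SLH A.
Proof.
move=> /(congr1 (@detH _ _)); rewrite detHM detH1 /SLH !detHM => PQ.
by rewrite mulrAC PQ mul1r.
Qed.

(** The determinant of [Q] follows from P Q = 1, and that of [A] from invariance under
    conjugation. *)
Lemma simple_SLH_intro (s : 'M[R]_n) A P Q : \det s = 1 -> SLH P ->
  P *m Q = 1%:M -> Q *m P = 1%:M -> A = P *m map_mx quatR s *m Q ->
  simple_SLH A.
Proof.
move=> s1 sP PQ QP eA; split.
  by rewrite eA SLH_conj // /SLH detH_quatR s1 expr1n rmorph1.
by exists s => //; exists P, Q; split=> //; apply: SLHV PQ.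
Qed.

Lemma simple_SLH_conj A P Q : SLH P -> P *m Q = 1%:M -> Q *m P = 1%:M ->
  simple_SLH A -> simple_SLH (P *m A *m Q).
Proof.
move=> sP PQ QP [_ [s s1 [h [h' [sh sh' hh' h'h ->]]]]].
apply: (@simple_SLH_intro s _ (P *m h) (h' *m Q)) => //.
- exact: SLHM.
- by rewrite mulmxA -(mulmxA P) hh' mulmx1.
- by rewrite mulmxA -(mulmxA h') QP mulmx1.
- by rewrite !mulmxA.
Qed.

End QuaternionicDeterminant.

(** * Elementary matrices and their products *)

Section Elementary.
Variable R : realType.
Local Notation H := (quat R).

Definition elem_mx n (i j : 'I_n) (b : H) : 'M[H]_n :=
  1%:M + b *: delta_mx i j.

Lemma mul_elem_mx n m (i j : 'I_n) b (A : 'M[H]_(n, m)) k l :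
  (elem_mx i j b *m A) k l = A k l + (if k == i then b * A j l else 0).
Proof.
rewrite mulmxDl mul1mx !mxE; congr (_ + _).
rewrite (bigD1 j) //= big1 ?addr0.
  by rewrite !mxE eqxx andbT; case: eqP; rewrite ?mulr1 ?mulr0 ?mul0r.
by move=> p /negPf pj; rewrite !mxE pj andbF mulr0 mul0r.
Qed.

Lemma mul_mx_elem n m (i j : 'I_n) b (A : 'M[H]_(m, n)) k l :
  (A *m elem_mx i j b) k l = A k l + (if l == j then A k i * b else 0).
Proof.
rewrite mulmxDr mulmx1 !mxE; congr (_ + _).
rewrite (bigD1 i) //= big1 ?addr0.
  by rewrite !mxE eqxx /=; case: eqP; rewrite ?mulr1 ?mulr0.
by move=> p /negPf pj; rewrite !mxE pj /= !mulr0.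
Qed.

Lemma elem_mxD n (i j : 'I_n) b c : i != j ->
  elem_mx i j b *m elem_mx i j c = elem_mx i j (b + c).
Proof.
move=> ij; apply/matrixP=> k l; rewrite mul_elem_mx !mxE.
have [->|ki] := eqVneq k i; last by rewrite /= !mulr0 !addr0.
rewrite [j == i]eq_sym (negPf ij) /= mulr0 addr0 -addrA; congr (_ + _).
rewrite ?eqxx [j == l]eq_sym /=.
by case: eqP => _; rewrite !(mulr0, mulr1) ?addr0 1?addrC.
Qed.

Lemma elem_mxN n (i j : 'I_n) b : i != j ->
  elem_mx i j b *m elem_mx i j (- b) = 1%:M.
Proof. by move=> ij; rewrite elem_mxD // subrr /elem_mx scale0r addr0. Qed.

(* Rescaling row [i] by 2 conjugates [elem_mx i j b] to its square. *)
Lemma SLH_elem n (i j : 'I_n) b : i != j -> SLH (elem_mx i j b).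
Proof.
move=> ij; pose D : 'M[R]_n := diag_mx (\row_k (if k == i then 2 else 1)).
have D0 : detH (map_mx quatR D) != 0.
  rewrite detH_quatR fmorph_eq0 sqrf_eq0 det_diag.
  by apply/prodf_neq0 => k _; rewrite mxE; case: ifP; rewrite ?oner_eq0 ?pnatr_eq0.
have E0 : detH (elem_mx i j b) != 0.
  apply/eqP=> E0; move/(congr1 (@detH _ _))/eqP: (elem_mxN b ij).
  by rewrite detHM E0 mul0r detH1 eq_sym oner_eq0.
have : map_mx quatR D *m elem_mx i j b = elem_mx i j (b + b) *m map_mx quatR D.
  rewrite /D map_diag_mx; apply/matrixP=> k l.
  rewrite mul_elem_mx mul_diag_mx !mxE mulrDr.
  have [->|ki] := eqVneq k i; last first.
    by rewrite /= !mulr0 rmorph1 mul1r !addr0.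
  rewrite /= [j == i]eq_sym (negPf ij) rmorph1 [j == l]eq_sym /=.
  have [->|lj] := eqVneq l j; last by rewrite !mulr0 !addr0 mulr_natr.
  rewrite (negPf ij) mulr0n mulr0 !add0r !mulr1 rmorph_nat.
  by rewrite mulr_natl mulr2n.
(* Cancelling the determinant of [D] leaves e = e^2 for the determinant e of the elementary matrix,
   and e is nonzero. *)
move/(congr1 (@detH _ _)); rewrite -elem_mxD // !detHM mulrC => /(mulIf D0).
by move=> /esym; rewrite -[RHS]mulr1 => /(mulfI E0).
Qed.

(** Products of elementary matrices, each carried along with its explicit inverse, so that
    conjugation by them stays inside SL(n, H). *)
Inductive elementary n : 'M[H]_n -> 'M[H]_n -> Prop :=
| Elementary1 : elementary 1%:M 1%:M
| ElementaryM P Q i j b : i != j -> elementary P Q ->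
    elementary (P *m elem_mx i j b) (elem_mx i j (- b) *m Q).

Lemma elementaryP n (P Q : 'M[H]_n) : elementary P Q ->
  [/\ SLH P, P *m Q = 1%:M & Q *m P = 1%:M].
Proof.
elim=> {P Q} [|P Q i j b ij _ [sP PQ QP]].
  by rewrite mulmx1; split=> //; apply: SLH1.
split; first by apply: SLHM => //; apply: SLH_elem.
  by rewrite mulmxA -(mulmxA P) elem_mxN // mulmx1.
by rewrite mulmxA -(mulmxA _ Q) QP mulmx1 -{2}[b]opprK elem_mxN.
Qed.

Lemma elementary_mul n (P Q P' Q' : 'M[H]_n) :
  elementary P Q -> elementary P' Q' -> elementary (P *m P') (Q' *m Q).
Proof.
move=> ePQ; elim=> {P' Q'} [|P' Q' i j b ij _ e]; first by rewrite mulmx1 mul1mx.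
by rewrite mulmxA -(mulmxA _ Q'); apply: ElementaryM.
Qed.

Lemma elementary_elem n (i j : 'I_n) b : i != j ->
  elementary (elem_mx i j b) (elem_mx i j (- b)).
Proof.
move=> ij; rewrite -[elem_mx _ _ b]mul1mx -[elem_mx _ _ (- b)]mulmx1.
by apply: ElementaryM => //; apply: Elementary1.
Qed.

(** Turns a conjugation of the trailing block into one of the whole matrix, as the induction of
    [conj_LDU] requires. *)
Lemma elementary_block m n (P Q : 'M[H]_n) : elementary P Q ->
  elementary (block_mx (1%:M : 'M_m) 0 0 P) (block_mx (1%:M : 'M_m) 0 0 Q).
Proof.
have elemE i j b : block_mx 1%:M 0 0 (elem_mx i j b) =
    elem_mx (rshift m i) (rshift m j) b :> 'M[H]_(m + n).
  apply/matrixP=> k l; rewrite !mxE.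
  case: (split_ordP k) => k' ->; rewrite !mxE; case: (split_ordP l) => l' ->;
    by rewrite !mxE ?eq_shift /= ?andbF ?mulr0 ?addr0.
elim=> {P Q} [|P Q i j b ij _ e]; first by rewrite -scalar_mx_block; constructor.
have := @ElementaryM (m + n) _ _ (rshift m i) (rshift m j) b _ e.
rewrite -!elemE !mulmx_block !(mul1mx, mul0mx, mulmx0, addr0, add0r, mulmx1).
by apply; rewrite eq_shift.
Qed.

End Elementary.

(** * Real pivots and LDU factorization up to conjugation *)

Section RealPivots.
Variable R : realType.
Local Notation H := (quat R).

(** Subtracting b times row i from row 0 makes the corner g00 - b gi0, which is 1 for the chosen b.
    The inverse column operation only changes column i, so the corner survives the conjugation. *)
Lemma real_pivot_offdiag n (g : 'M[H]_n.+1) i : i != 0 -> g i 0 != 0 ->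
  exists P Q, elementary P Q /\ (Q *m g *m P) 0 0 = 1.
Proof.
move=> i0 /quat_inverse[y gy yg]; pose b := (g 0 0 - 1) * y.
exists (elem_mx 0 i b), (elem_mx 0 i (- b)); split.
  by apply: elementary_elem; rewrite eq_sym.
rewrite mul_mx_elem [0 == i]eq_sym (negPf i0) addr0 mul_elem_mx eqxx.
by rewrite mulNr -mulrA yg mulr1 opprB addrC subrK.
Qed.

(** If column 0 is zero below the corner and the corner is not real, a preliminary conjugation by
    [elem_mx 1 0 p] creates a nonzero entry below it. This reduces to [real_pivot_offdiag]. *)
Lemma real_pivot n (g : 'M[H]_n.+2) : (exists i, g i 0 != 0) ->
  exists P Q (a : R), [/\ elementary P Q, a != 0 & (Q *m g *m P) 0 0 = quatR a].
Proof.
case=> i gi0.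
have unit_pivot : (exists P Q, elementary P Q /\ (Q *m g *m P) 0 0 = 1) ->
    exists P Q (a : R), [/\ elementary P Q, a != 0 & (Q *m g *m P) 0 0 = quatR a].
  by case=> P [Q [e1 e2]]; exists P, Q, 1; rewrite rmorph1 oner_eq0.
have [[k /andP[k0 gk]]|col0] :=
    altP (@existsP _ (fun k : 'I__ => (k != 0) && (g k 0 != 0))).
  by apply: unit_pivot; apply: real_pivot_offdiag gk.
have g0 k : k != 0 -> g k 0 = 0.
  by move=> k0; apply: contraNeq col0 => gk; apply/existsP; exists k; rewrite k0.
have g00 : g 0 0 != 0 by move: gi0; have [->|/g0->] := eqVneq i 0; rewrite ?eqxx.
have [gR|gNR] := eqVneq (g 0 0) (quatR (complex.Re (quat_fst (g 0 0)))).
  exists 1%:M, 1%:M, (complex.Re (quat_fst (g 0 0))).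
  rewrite mul1mx mulmx1 -gR; split=> //; first exact: Elementary1.
  by apply: contraNneq g00 => e; rewrite gR e rmorph0.
apply: unit_pivot.
have [q q0] : exists q, g 1 1 * q - q * g 0 0 != 0.
  by apply: sylvester_neq0 => r; apply: contraNneq gNR => ->; rewrite /=.
(* The linear part of the new (1, 0) entry does not vanish at [q], hence the
   entry itself does not vanish at both [q] and [- q]. *)
have [p p0] : exists p, g 1 1 * p - p * g 0 0 - p * g 0 1 * p != 0.
  have [e|] := eqVneq (g 1 1 * q - q * g 0 0 - q * g 0 1 * q) 0; last by exists q.
  (* When the entry vanishes at q, its value at - q is minus twice the linear part. *)
  exists (- q); apply: contraNneq q0; rewrite !mulrN !mulNr !opprK -(subr0_eq e).
  rewrite [- (g 1 1 * q) + _]addrC -[q * g 0 0 - _]opprB -opprD -mulr2n.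
  move=> /eqP; rewrite oppr_eq0 -mulr_natl -(rmorph_nat (@quatR R)) => /eqP.
  move=> /(congr1 ( *%R (quatR 2^-1))).
  by rewrite mulr0 mulrA -rmorphM mulVf ?pnatr_eq0 // rmorph1 mul1r => ->.
pose g1 := elem_mx 1 0 (- p) *m g *m elem_mx 1 0 p.
have g10 : g1 1 0 != 0.
  rewrite mul_mx_elem eqxx !mul_elem_mx eqxx [g 1 0]g0 // add0r !mulNr mulrBl.
  by rewrite addrC addrAC.
have [//|P [Q [e1 e2]]] := @real_pivot_offdiag _ g1 1 _ g10.
exists (elem_mx 1 0 p *m P), (Q *m elem_mx 1 0 (- p)); split.
  by apply: elementary_mul => //; apply: elementary_elem.
by rewrite -[RHS]e2 /g1 !mulmxA.
Qed.

Definition unitri n (L : 'M[H]_n) := is_trig_mx L /\ forall i, L i i = 1.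

Lemma unitri_block n (C : 'cV[H]_n) (L : 'M[H]_n) :
  unitri L -> unitri (block_mx (1%:M : 'M_1) 0 C L).
Proof.
move=> [tL dL]; split.
  by rewrite is_trig_block_mx // eqxx tL andbT; apply: is_diag_mx_is_trig;
    apply: scalar_mx_is_diag.
move=> i; case: (split_ordP i) => k ->; rewrite ?block_mxEul ?block_mxEdr //.
by rewrite mxE eqxx.
Qed.

(** Block elimination: once the corner is a nonzero real, the induction applies to the Schur
    complement, which is again regular. *)
Lemma conj_LDU n (g : 'M[H]_n.+1) : (forall X : 'M_n.+1, g *m X = 0 -> X = 0) ->
  exists (P Q L U : 'M_n.+1) (t : 'rV_n.+1), [/\ elementary P Q, unitri L,
    unitri U^T,
    forall i : 'I_n.+1, (i < n)%N -> exists2 a : R, a != 0 & t 0 i = quatR a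
    & Q *m g *m P = L *m diag_mx t *m U].
Proof.
elim: n g => [|n IHn] g reg_g.
  (* In size 1 the matrix is its own diagonal, and no entry has to be real. *)
  exists 1%:M, 1%:M, 1%:M, 1%:M, g; split=> //.
  - exact: Elementary1.
  - by split=> [|i]; rewrite ?mxE ?eqxx //; apply: is_diag_mx_is_trig;
      apply: scalar_mx_is_diag.
  - by rewrite trmx1; split=> [|i]; rewrite ?mxE ?eqxx //;
      apply: is_diag_mx_is_trig; apply: scalar_mx_is_diag.
  - rewrite !mul1mx !mulmx1; apply/matrixP=> i j.
    by rewrite !ord1 mxE eqxx.
have [|P1 [Q1 [a [e1 a0 pivot]]]] := @real_pivot n g.
  apply/existsP; apply: contraT; rewrite negb_exists => /forallP g0.
  (* If column 0 were zero, [g] would kill this nonzero matrix. *)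
  have : delta_mx 0 0 = 0 :> 'M[H]_n.+2.
    apply: reg_g; apply/matrixP=> i j; rewrite !mxE big1 // => k _; rewrite !mxE.
    have [->|] := eqVneq k 0; last by rewrite mulr0.
    by move: (g0 i); rewrite negbK => /eqP->; rewrite mul0r.
  by move/matrixP/(_ 0 0)/eqP; rewrite !mxE eqxx oner_eq0.
have [_ P1Q1 Q1P1] := elementaryP e1.
have [g1 def_g1] : exists g1, g1 = Q1 *m g *m P1 by eexists.
rewrite -def_g1 in pivot.
have reg_g1 (X : 'M_n.+2) : g1 *m X = 0 -> X = 0.
  rewrite def_g1 -!mulmxA => /(congr1 (mulmx P1)); rewrite mulmxA P1Q1 mul1mx mulmx0.
  by move=> /reg_g /(congr1 (mulmx Q1)); rewrite mulmxA Q1P1 mul1mx mulmx0.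
pose B := ursubmx (g1 : 'M_(1 + n.+1)); pose C := dlsubmx (g1 : 'M_(1 + n.+1)).
pose D := drsubmx (g1 : 'M_(1 + n.+1)).
have g1E : g1 = block_mx (quatR a)%:M B C D.
  have <- : ulsubmx (g1 : 'M_(1 + n.+1)) = (quatR a)%:M.
    apply/matrixP=> i j; rewrite !ord1 !mxE eqxx mulr1n -pivot.
    have -> : lshift n.+1 (0 : 'I_1) = 0 :> 'I_n.+2 by apply: val_inj.
    by [].
  by rewrite [RHS](@submxK _ 1 n.+1 1 n.+1).
pose ai : 'M[H]_1 := (quatR a^-1)%:M.
have aai : (quatR a)%:M *m ai = 1%:M.
  by rewrite -scalar_mxM -rmorphM mulfV // rmorph1.
have aia : ai *m (quatR a)%:M = 1%:M.
  by rewrite -scalar_mxM -rmorphM mulVf // rmorph1.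
pose S := D - C *m ai *m B.
have [X SX0|P2 [Q2 [L [U [t [e2 tL tU tR eS]]]]]] := IHn S.
  (* A matrix X killed by the Schur complement lifts to one killed by [g1], with - a^-1 B X as its
     top rows. *)
  have /(_ (@block_mx _ 1 n.+1 1 n.+1 0 (- ai *m B *m X) 0 X)) := reg_g1.
  rewrite g1E (@mulmx_block _ 1 n.+1 1 n.+1 1 n.+1) !mulmx0.
  rewrite !addr0 !mulmxA mulmxN aai mulNmx mul1mx mulNmx.
  rewrite addNr mulmxN !mulNmx.
  have -> : - (C *m ai *m B *m X) + D *m X = S *m X by rewrite mulmxBl addrC.
  rewrite SX0 block_mx0 => /(_ erefl)/(congr1 (@drsubmx _ 1 n.+1 1 n.+1)).
  by rewrite block_mxKdr => ->; apply/matrixP=> i j; rewrite !mxE.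
have [_ P2Q2 Q2P2] := elementaryP e2.
(* Conjugation by the block matrix of 1 and P2 replaces B, C, S by B P2, Q2 C, Q2 S P2. The
   triangular factors are those of block elimination. *)
exists (P1 *m block_mx (1%:M : 'M_1) 0 0 P2),
  (block_mx (1%:M : 'M_1) 0 0 Q2 *m Q1),
  (block_mx (1%:M : 'M_1) 0 (Q2 *m C *m ai) L),
  (block_mx (1%:M : 'M_1) (ai *m B *m P2) 0 U), (row_mx (quatR a)%:M t).
split.
- by apply: elementary_mul => //; apply: (@elementary_block R 1 n.+1).
- exact: unitri_block.
- by rewrite (@tr_block_mx _ 1 n.+1 1 n.+1) trmx1 trmx0; apply: unitri_block.
- move=> i; case: (@split_ordP 1 n.+1 i) => k -> lekn.
    by exists a; rewrite // (@row_mxEl _ 1 1 n.+1) ord1 mxE eqxx.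
  by rewrite (@row_mxEr _ 1 1 n.+1); apply: tR.
rewrite -!mulmxA (mulmxA Q1) (mulmxA _ P1) -def_g1 g1E (@diag_mx_row _ n.+1 1).
have -> : diag_mx (quatR a)%:M = (quatR a)%:M :> 'M[H]_1.
  by apply/matrixP=> i j; rewrite !ord1 !mxE.
rewrite !(@mulmx_block _ 1 n.+1 1 n.+1 1 n.+1).
rewrite !(mul1mx, mul0mx, mulmx0, addr0, add0r, mulmx1) !mulmxA.
rewrite aai mul1mx -[_ *m ai *m (quatR a)%:M]mulmxA aia mulmx1.
by rewrite -eS /S mulmxBr mulmxBl !mulmxA addrC subrK.
Qed.

End RealPivots.

(** * Triangular matrices with distinct real diagonal entries *)

Section Triangular.
Variable R : realType.
Local Notation H := (quat R).

(** By induction on the blocks. Clearing the first column amounts to a Sylvester equation, solvable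
    entrywise because the diagonal entries are central and distinct. *)
Lemma trig_diagonalize n (A : 'M[H]_n) (p : 'rV[R]_n) :
  injective (p 0) -> is_trig_mx A -> (forall i, A i i = quatR (p 0 i)) ->
  exists M N : 'M[H]_n, [/\ unitri M, M *m N = 1%:M, N *m M = 1%:M
    & A = M *m map_mx quatR (diag_mx p) *m N].
Proof.
move=> + tA; elim/trigsqmx_ind: tA p => {n A} [|n x c A _ IHA] p inj_p dA.
  exists 1%:M, 1%:M; rewrite mul1mx !mulmx1; split=> //.
    by split; [apply/is_trig_mxP; case | case].
  by apply/matrixP; case.
pose p0 := p 0 (lshift n 0); pose q := rsubmx p.
have dA' i : A i i = quatR (q 0 i).
  by rewrite /q mxE -dA block_mxEdr.
have inj_q : injective (q 0).
  by move=> i j; rewrite !mxE => /inj_p/rshift_inj.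
have p0q i : p0 - q 0 i != 0.
  by rewrite subr_eq0 mxE; apply/eqP => /inj_p/eqP; rewrite eq_shift.
have [M [N [uM MN NM eA]]] := IHA q inj_q dA'.
(* The solution of N c + diag(q) Z = Z p0. *)
pose Z : 'cV[H]_n := \col_i (quatR (p0 - q 0 i)^-1 * (N *m c) i 0).
have eZ : N *m c + map_mx quatR (diag_mx q) *m Z = Z *m (quatR p0)%:M.
  apply/matrixP=> i j; rewrite !ord1 map_diag_mx mul_diag_mx.
  rewrite -diag_const_mx mul_mx_diag.
  rewrite mxE [in X in _ + X]mxE [RHS]mxE ![Z _ _]mxE [const_mx _ _ _]mxE.
  rewrite [map_mx _ _ _ _]mxE -quatR_comm mulrA -rmorphM mulrA -rmorphM.
  rewrite -[X in X + _]mul1r -(rmorph1 (@quatR R)) -mulrDl -rmorphD.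
  congr (quatR _ * _); field; exact: p0q.
exists (block_mx (1%:M : 'M_1) 0 (M *m Z) M).
exists (block_mx (1%:M : 'M_1) 0 (- Z) N); split.
- exact: unitri_block.
- rewrite mulmx_block !(mul1mx, mul0mx, mulmx0, addr0, add0r, mulmx1).
  by rewrite mulmxN subrr MN -scalar_mx_block.
- rewrite mulmx_block !(mul1mx, mul0mx, mulmx0, addr0, add0r, mulmx1).
  by rewrite mulmxA NM mul1mx addNr -scalar_mx_block.
have -> : map_mx quatR (diag_mx p) =
    block_mx (quatR p0)%:M 0 0 (map_mx quatR (diag_mx q)).
  rewrite -[in LHS](hsubmxK p) diag_mx_row map_block_mx !map_mx0; congr block_mx.
  by apply/matrixP=> i j; rewrite !ord1 !mxE.
have -> : x = (quatR p0)%:M.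
  apply/matrixP=> i j; rewrite !ord1 mxE eqxx mulr1n /p0 -dA.
  by rewrite block_mxEul.
rewrite !mulmx_block !(mul1mx, mul0mx, mulmx0, addr0, add0r, mulmx1) -eA.
congr block_mx; rewrite -mulmxA -eZ mulmxDr mulmxA MN mul1mx -addrA.
by rewrite mulmxN !mulmxA subrr addr0.
Qed.

(* Transposition alone does not reverse products over a noncommutative ring;
   conjugate transposition does. *)
Definition ctrmx m n (A : 'M[H]_(m, n)) : 'M[H]_(n, m) :=
  (map_mx (@qconj R) A)^T.

Lemma ctrmxK m n (A : 'M[H]_(m, n)) : ctrmx (ctrmx A) = A.
Proof. by apply/matrixP=> i j; rewrite !mxE qconjK. Qed.

Lemma ctrmx_mul m n p (A : 'M[H]_(m, n)) (B : 'M[H]_(n, p)) :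
  ctrmx (A *m B) = ctrmx B *m ctrmx A.
Proof.
apply/matrixP=> i j; rewrite !mxE raddf_sum /=.
by apply: eq_bigr => k _; rewrite !mxE qconjM.
Qed.

Lemma ctrmx1 n : ctrmx (1%:M : 'M_n) = 1%:M.
Proof.
apply/matrixP=> i j; rewrite !mxE eq_sym.
by case: eqP; rewrite -?(rmorph1 (@quatR R)) ?qconjR // raddf0.
Qed.

Lemma ctrmx_trig n (A : 'M[H]_n) : is_trig_mx A -> is_trig_mx (ctrmx A)^T.
Proof.
by move/is_trig_mxP=> tA; apply/is_trig_mxP=> i j ij; rewrite !mxE tA ?raddf0.
Qed.

(** The conjugate transpose of [A] is lower triangular with the same real diagonal. *)
Lemma trig_diagonalize_tr n (A : 'M[H]_n) (p : 'rV[R]_n) :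
  injective (p 0) -> is_trig_mx A^T -> (forall i, A i i = quatR (p 0 i)) ->
  exists M N : 'M[H]_n, [/\ unitri M^T, M *m N = 1%:M, N *m M = 1%:M
    & A = N *m map_mx quatR (diag_mx p) *m M].
Proof.
move=> inj_p /is_trig_mxP tA dA.
have [|i|M [N [[tM dM] MN NM eA]]] := @trig_diagonalize n (ctrmx A) p inj_p.
- by apply/is_trig_mxP=> i j /tA; rewrite !mxE => ->; rewrite raddf0.
- by rewrite !mxE dA qconjR.
exists (ctrmx M), (ctrmx N); split.
- split=> [|i]; first exact: ctrmx_trig.
  by rewrite !mxE dM -(rmorph1 (@quatR R)) qconjR.
- by rewrite -ctrmx_mul NM ctrmx1.
- by rewrite -ctrmx_mul MN ctrmx1.
rewrite -[LHS]ctrmxK eA !ctrmx_mul -mulmxA; congr (_ *m (_ *m _)).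
apply/matrixP=> i j; rewrite !mxE eq_sym.
by case: eqP => [->|]; rewrite ?mulr1n ?mulr0n qconjR.
Qed.

Lemma trig_mul_diag n (L : 'M[H]_n) (d : 'rV[H]_n) :
  is_trig_mx L -> is_trig_mx (L *m diag_mx d).
Proof.
move/is_trig_mxP=> tL; apply/is_trig_mxP=> i j ij.
by rewrite mul_mx_diag mxE tL // mul0r.
Qed.

Lemma detH_diagonalized n (A M N : 'M[H]_n) (p : 'rV[R]_n) : M *m N = 1%:M ->
  A = M *m map_mx quatR (diag_mx p) *m N ->
  detH A = detH (map_mx quatR (diag_mx p)).
Proof.
move=> /(congr1 (@detH _ _)); rewrite detHM detH1 => MN ->.
by rewrite !detHM mulrAC MN mul1r.
Qed.

(** The auxiliary diagonal 1, ..., n: multiplying a unitriangular matrix by it makes the diagonal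
    entries distinct and keeps them real and nonzero. *)
Let succ_row n : 'rV[R]_n := \row_i (i.+1)%:R.

Let succ_row_inj n : injective (succ_row n 0).
Proof. by move=> i j; rewrite !mxE => /eqP; rewrite eqr_nat => /eqP[/val_inj]. Qed.

Let detH_succ_row n : detH (map_mx quatR (diag_mx (succ_row n))) != 0.
Proof.
rewrite detH_quatR fmorph_eq0 sqrf_eq0 det_diag.
by apply/prodf_neq0 => i _; rewrite mxE pnatr_eq0.
Qed.

(** L D is conjugate to D for a real diagonal D with distinct nonzero entries, so the determinant of
    D cancels. *)
Lemma SLH_unitri n (L : 'M[H]_n) : unitri L -> SLH L.
Proof.
move=> [tL dL]; set D := map_mx quatR (diag_mx (succ_row n)).
have [||M [N [_ MN _ eLD]]] := @trig_diagonalize n (L *m D) _ (@succ_row_inj n).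
- by rewrite /D map_diag_mx; apply: trig_mul_diag.
- by move=> i; rewrite /D map_diag_mx mul_mx_diag !mxE dL mul1r.
apply: (mulIf (detH_succ_row n)); rewrite mul1r -detHM.
exact: detH_diagonalized MN eLD.
Qed.

Lemma SLH_unitri_tr n (U : 'M[H]_n) : unitri U^T -> SLH U.
Proof.
move=> [tU dU]; have dU' i : U i i = 1 by rewrite -[RHS](dU i) mxE.
set D := map_mx quatR (diag_mx (succ_row n)).
have [||M [N [_ _ NM eDU]]] := @trig_diagonalize_tr n (D *m U) _ (@succ_row_inj n).
- apply/is_trig_mxP=> i j ij; rewrite mxE /D map_diag_mx mul_diag_mx mxE.
  by move/is_trig_mxP: tU => /(_ i j ij); rewrite mxE => ->; rewrite mulr0.
- by move=> i; rewrite /D map_diag_mx mul_diag_mx !mxE dU' mulr1.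
apply: (mulfI (detH_succ_row n)); rewrite mulr1 -detHM.
exact: detH_diagonalized NM eDU.
Qed.

(** The product has diagonal p, so a unitriangular matrix conjugates it to diag(p). *)
Lemma simple_lower n (L : 'M[H]_n) (p : 'rV[R]_n) :
  unitri L -> injective (p 0) -> \prod_i p 0 i = 1 ->
  simple_SLH (L *m map_mx quatR (diag_mx p)).
Proof.
move=> [tL dL] inj_p p1.
have [||M [N [uM MN NM eLD]]] :=
  @trig_diagonalize n (L *m map_mx quatR (diag_mx p)) _ inj_p.
- by rewrite map_diag_mx; apply: trig_mul_diag.
- by move=> i; rewrite map_diag_mx mul_mx_diag !mxE dL mul1r.
by apply: simple_SLH_intro eLD => //; rewrite ?det_diag //; apply: SLH_unitri.
Qed.

Lemma simple_upper n (U : 'M[H]_n) (p : 'rV[R]_n) :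
  unitri U^T -> injective (p 0) -> \prod_i p 0 i = 1 ->
  simple_SLH (map_mx quatR (diag_mx p) *m U).
Proof.
move=> [tU dU] inj_p p1; have dU' i : U i i = 1 by rewrite -[RHS](dU i) mxE.
have [||M [N [uM MN NM eDU]]] :=
  @trig_diagonalize_tr n (map_mx quatR (diag_mx p) *m U) _ inj_p.
- apply/is_trig_mxP=> i j ij; rewrite mxE map_diag_mx mul_diag_mx mxE.
  by move/is_trig_mxP: tU => /(_ i j ij); rewrite mxE => ->; rewrite mulr0.
- by move=> i; rewrite map_diag_mx mul_diag_mx !mxE dU' mulr1.
apply: simple_SLH_intro eDU => //; rewrite ?det_diag //.
by apply: SLHV MN; apply: SLH_unitri_tr.
Qed.

End Triangular.

(** * Determinants of dilations *)

Section Dilations.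
Variable R : realType.
Local Notation H := (quat R).

Definition dilation n (k : 'I_n) (x : H) : 'M[H]_n :=
  diag_mx (\row_j (if j == k then x else 1)).

Lemma dilationM n (k : 'I_n) x y :
  dilation k x *m dilation k y = dilation k (x * y).
Proof.
rewrite /dilation mulmx_diag; congr diag_mx; apply/rowP=> j; rewrite !mxE.
by case: eqP; rewrite ?mulr1.
Qed.

Lemma dilation1 n (k : 'I_n) : dilation k 1 = 1%:M.
Proof.
rewrite /dilation -diag_const_mx; congr diag_mx.
by apply/rowP=> j; rewrite !mxE if_same.
Qed.

Lemma detH_dilationM n (k : 'I_n) x y :
  detH (dilation k (x * y)) = detH (dilation k x) * detH (dilation k y).
Proof. by rewrite -dilationM detHM. Qed.

Lemma detH_dilationR n (k : 'I_n) r :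
  detH (dilation k (quatR r)) = real_complex R (r ^+ 2).
Proof.
have -> : dilation k (quatR r) =
    map_mx quatR (diag_mx (\row_j (if j == k then r else 1))).
  rewrite map_diag_mx; congr diag_mx; apply/rowP=> j; rewrite !mxE.
  by case: eqP; rewrite ?rmorph1.
rewrite detH_quatR det_diag (bigD1 k) //= mxE eqxx big1 ?mulr1 // => j /negPf jk.
by rewrite mxE jk.
Qed.

Lemma sqrN1_nonreal (y : H) : y * y = -1 -> forall r, y != quatR r.
Proof.
move=> yy r; apply/eqP => yr; move/eqP: yy; rewrite yr -rmorphM.
rewrite -(rmorphN1 (@quatR R)) (inj_eq (fmorph_inj _)) -subr_eq0 opprK -expr2.
by rewrite gt_eqF // ltr_wpDl ?sqr_ge0.
Qed.

(* Square roots of -1 are conjugate: [q := x w + w y] satisfies [x q = q y]. *)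
Lemma detH_dilation_sqrtN1 n (k : 'I_n) (x y : H) :
  x * x = -1 -> y * y = -1 -> detH (dilation k x) = detH (dilation k y).
Proof.
move=> xx yy; have [|w] := @sylvester_neq0 _ (- y) x.
  by apply: sqrN1_nonreal; rewrite mulrNN.
rewrite mulrN opprK; set q := x * w + w * y => q0.
have xq : x * q = q * y.
  by rewrite mulrDl mulrDr mulrA xx -(mulrA w) yy mulrN1 mulN1r mulrA addrC.
have [q' qq' _] := quat_inverse q0.
have dq0 : detH (dilation k q) != 0.
  apply/eqP=> dq0; move/(congr1 (fun z => detH (dilation k z)))/eqP: qq'.
  by rewrite detH_dilationM dq0 mul0r dilation1 detH1 eq_sym oner_eq0.
by apply: (mulIf dq0); rewrite -detH_dilationM xq detH_dilationM mulrC.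
Qed.

(** In polar form x = r e the real factor contributes r^2. The unit e = (e u)(- u) is a product of
    two square roots of -1, which have equal determinants. Hence e has the same determinant as (e
    u)^2 = -1, namely 1. *)
Lemma detH_dilation n (k : 'I_n) x :
  detH (dilation k x) = real_complex R (qnorm x).
Proof.
have [->|x0] := eqVneq x 0.
  (* The determinant at 0 equals 4 times itself. *)
  have : detH (dilation k (0 * quatR 2)) = detH (dilation k 0) by rewrite mul0r.
  rewrite detH_dilationM detH_dilationR => /eqP; rewrite -subr_eq0 -[X in _ - X]mulr1.
  rewrite -mulrBr -(rmorph1 (real_complex R)) -rmorphB mulf_eq0 fmorph_eq0.
  have -> : (2 ^+ 2 - 1 == 0 :> R) = false by apply/eqP => ?; lra.
  rewrite orbF => /eqP->; have /eqP-> : qnorm (0 : H) == 0 by rewrite qnorm_eq0.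
  by rewrite rmorph0.
have [r [e [r0 ne ->]]] := quat_polar x0.
rewrite detH_dilationM detH_dilationR qnormM qnormR ne mulr1.
have [u uu eueu] := unit_quat_factor ne.
have -> : e = (e * u) * - u by rewrite mulrN -mulrA uu mulrN1 opprK.
rewrite detH_dilationM (@detH_dilation_sqrtN1 _ _ (- u) (e * u)) ?mulrNN //.
rewrite -detH_dilationM eueu -(rmorphN1 (@quatR R)) detH_dilationR.
by rewrite sqrrN expr1n mulr1.
Qed.

Lemma SLH_dilation n (k : 'I_n) x : qnorm x = 1 -> SLH (dilation k x).
Proof. by move=> nx; rewrite /SLH detH_dilation nx. Qed.

End Dilations.

(** * Square roots of -1 on the diagonal and the real quarter turn *)

Section QuarterTurn.
Variable R : realType.
Local Notation H := (quat R).

Lemma ord2_cases (i : 'I_2) : i = 0 \/ i = 1.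
Proof. by case: i => [[|[|//]] ?]; [left|right]; apply: val_inj. Qed.

Definition rotation90 : 'M[R]_2 :=
  \matrix_(i, j) (if (i < j)%N then -1 else if (j < i)%N then 1 else 0).

Lemma det_rotation90 : \det rotation90 = 1.
Proof.
rewrite (expand_det_row _ 0) !big_ord_recl big_ord0 /cofactor !det_mx11 !mxE /=.
by rewrite expr1; ring.
Qed.

(** Put D = diag(x, y), so D^2 = -1. In the basis v, D v with v = (1, q), D acts as the quarter
    turn. These vectors form a basis when y q - q x is nonzero, and such a q exists because x is not
    real. *)
Lemma sqrtN1_simple (x y : H) : x * x = -1 -> y * y = -1 ->
  simple_SLH (diag_mx (\row_(i < 3) [:: 1; x; y]`_i)).
Proof.
move=> xx yy; have [|q0 q0P] := @sylvester_neq0 _ x y.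
  exact: sqrN1_nonreal.
have [r [e [r0 ne eq0]]] := quat_polar q0P.
(* Rescaling by a real makes e = y q - q x a unit, which puts the change of basis in SL(2, H). *)
pose q := quatR r^-1 * q0.
have eE : e = y * q - q * x.
  rewrite /q mulrA -quatR_comm -!mulrA -mulrBr eq0 mulrA -rmorphM mulVf //.
  by rewrite rmorph1 mul1r.
have [e' ee' e'e] : exists2 e', e * e' = 1 & e' * e = 1.
  apply: quat_inverse; rewrite -qnorm_eq0 ne; exact: oner_neq0.
(* This is the matrix with columns (1, q) and (x, y q), factored so that its inverse and determinant
   are explicit. *)
pose P : 'M[H]_2 := elem_mx 1 0 q *m (dilation 1 e *m elem_mx 0 1 x).
pose Q : 'M[H]_2 := elem_mx 0 1 (- x) *m (dilation 1 e' *m elem_mx 1 0 (- q)).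
have PQ : P *m Q = 1%:M.
  rewrite /P /Q !mulmxA -(mulmxA _ (elem_mx 0 1 x)) elem_mxN // mulmx1.
  by rewrite -(mulmxA _ (dilation 1 e)) dilationM ee' dilation1 mulmx1 elem_mxN.
have QP : Q *m P = 1%:M.
  rewrite /P /Q !mulmxA -(mulmxA _ (elem_mx 1 0 (- q))) -{2}[q]opprK elem_mxN //.
  rewrite mulmx1 -(mulmxA _ (dilation 1 e')) dilationM e'e dilation1 mulmx1.
  by rewrite -{2}[x]opprK elem_mxN.
pose D : 'M[H]_2 := diag_mx (\row_(i < 2) [:: x; y]`_i).
have DP : D *m P = P *m map_mx quatR rotation90.
  have PE i j : P i j = if i == 0 then (if j == 0 then 1 else x)
                        else (if j == 0 then q else y * q).
    rewrite /P mul_elem_mx !mul_mx_elem !mxE.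
    have [->|->] := ord2_cases i.
      have [->|->] := ord2_cases j.
        by rewrite /= !addr0.
      by rewrite /= mul1r addr0 add0r.
    have [->|->] := ord2_cases j.
      by rewrite /= !addr0 add0r mulr1.
    by rewrite /= mul1r mul0r addr0 add0r eE subrK.
  apply/matrixP=> i j; rewrite mul_diag_mx mxE [RHS]mxE.
  rewrite !big_ord_recl big_ord0 !PE !mxE.
  have [->|->] := ord2_cases i.
    have [->|->] := ord2_cases j.
      by rewrite /= rmorph0 rmorph1 !mulr1 mulr0 add0r addr0.
    by rewrite /= rmorph0 rmorphN1 mulr0 !addr0 mul1r.
  have [->|->] := ord2_cases j.
    by rewrite /= rmorph0 rmorph1 mulr1 mulr0 add0r addr0.
  by rewrite /= rmorph0 rmorphN1 mulr0 !addr0 mulrA yy mulN1r mulrN1.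
pose blk (A : 'M[H]_2) : 'M[H]_(1 + 2) := block_mx (1%:M : 'M_1) 0 0 A.
have blkM A B : blk (A *m B) = blk A *m blk B.
  by rewrite /blk mulmx_block !(mul1mx, mul0mx, mulmx0, addr0, add0r).
have blk1 : blk 1%:M = 1%:M by rewrite /blk -scalar_mx_block.
apply: (@simple_SLH_intro _ _ (block_mx (1%:M : 'M_1) 0 0 rotation90 : 'M_(1 + 2))
  _ (blk P) (blk Q)).
- by rewrite det_ublock det1 mul1r det_rotation90.
- have SLH_elem_blk i j b : i != j -> SLH (blk (elem_mx i j b)).
    by move=> ij; have [] := elementaryP (elementary_block 1 (elementary_elem b ij)).
  have blk_dil : blk (dilation 1 e) = dilation (rshift 1 1) e.
    rewrite /blk /dilation -diag_const_mx -diag_mx_row; congr diag_mx.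
    apply/rowP=> j; rewrite !mxE; case: split_ordP => k ->; rewrite !mxE;
      by rewrite eq_shift.
  rewrite !blkM blk_dil; apply: SLHM; first exact: SLH_elem_blk.
  by apply: SLHM; [apply: SLH_dilation | apply: SLH_elem_blk].
- by rewrite -blkM PQ blk1.
- by rewrite -blkM QP blk1.
rewrite map_block_mx !map_mx0 map_mx1 -/(blk _) -!blkM -DP -mulmxA PQ mulmx1.
rewrite /blk -diag_const_mx -diag_mx_row; congr diag_mx.
apply/rowP=> i; rewrite mxE; case: (@split_ordP 1 2 i) => k ->.
  by rewrite row_mxEl mxE ord1.
by rewrite row_mxEr mxE.
Qed.

End QuarterTurn.

(** * The factorization into four simple elements *)

Theorem theorem1p4 (R : realType) (g : 'M[quat R]_3) (hg : SLH g) :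
  exists g1 g2 g3 g4 : 'M[quat R]_3,
    [/\ simple_SLH g1, simple_SLH g2, simple_SLH g3, simple_SLH g4
      & g = g1 *m g2 *m g3 *m g4].
Proof.
have [P [Q [L [U [t [ePQ uL uU tR eg]]]]]] := conj_LDU (SLH_regular hg).
have [sP PQ QP] := elementaryP ePQ.
have [a a0 ta] := tR 0 isT; have [b b0 tb] := tR 1 isT.
(* The reals a, b, c have product 1, and the last entry of t is c d. *)
pose o2 : 'I_3 := ord_max; pose c := (a * b)^-1; pose d := quatR (a * b) * t 0 o2.
have ab0 : a * b != 0 by rewrite mulf_neq0.
have dc : t 0 o2 = quatR c * d.
  by rewrite /d mulrA -rmorphM mulVf // rmorph1 mul1r.
have nd : qnorm d = 1.
  (* The determinant of diag(t) is 1 by the factorization of g, and it is also the norm of d, since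
     diag(a, b, c) has determinant 1. *)
  have : detH (diag_mx t) = 1.
    have sL := SLH_unitri uL; have sU := SLH_unitri_tr uU.
    have : SLH (Q *m g *m P) by rewrite SLH_conj.
    by rewrite eg /SLH !detHM sL sU mul1r mulr1.
  have -> : diag_mx t =
      map_mx quatR (diag_mx (\row_i [:: a; b; c]`_i)) *m dilation o2 d.
    rewrite map_diag_mx mulmx_diag; congr diag_mx; apply/rowP=> i; rewrite !mxE.
    case: i => -[|[|[|//]]] i3.
    - by rewrite (_ : Ordinal i3 = 0) ?ta ?mulr1 //; apply: val_inj.
    - by rewrite (_ : Ordinal i3 = 1) ?tb ?mulr1 //; apply: val_inj.
    - by rewrite (_ : Ordinal i3 = o2) ?dc //; apply: val_inj.
  rewrite detHM detH_quatR det_diag !big_ord_recl big_ord0 !mxE /= mulr1.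
  rewrite mulrA mulfV // expr1n rmorph1 mul1r detH_dilation.
  by rewrite -(rmorph1 (real_complex R)) => /fmorph_inj.
have [u uu dudu] := unit_quat_factor nd.
(* [s] is large enough for both [p] and [q] to have distinct entries. *)
pose s := 2 + `|b / a| + `|a / c| + `|b / c|.
(* Entrywise p times q is (a, b, c), and the entries of each have product 1. *)
pose p : 'rV[R]_3 := \row_i [:: 1; s; s^-1]`_i.
pose q : 'rV[R]_3 := \row_i [:: a; b / s; s * c]`_i.
have c0 : c != 0 by rewrite invr_neq0.
have [na nb nc] : [/\ 0 <= `|b / a|, 0 <= `|a / c| & 0 <= `|b / c|] by [].
have s2 : 2 <= s by rewrite /s; lra.
have s0 : s != 0 by apply/eqP; lra.
have lt_s z : `|z| < s -> z != s.
  by apply: contraTneq => ->; rewrite -leNgt ler_norm.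
have inj3 (v : 'rV[R]_3) x y z : v = \row_i [:: x; y; z]`_i ->
    x != y -> x != z -> y != z -> injective (v 0).
  move=> -> xy xz yz [[|[|[|//]]] i3] [[|[|[|//]]] j3]; rewrite !mxE /= => e;
    by [apply: val_inj | rewrite e eqxx in xy | rewrite e eqxx in xz
      | rewrite e eqxx in yz].
have inj_p : injective (p 0).
  apply: (inj3 _ _ _ _ erefl); first by apply/eqP; lra.
    by rewrite eq_sym invr_eq1; apply/eqP; lra.
  apply: contraTneq s2 => e; rewrite -ltNge.
  have : s * s = 1 by rewrite [in X in _ * X]e mulfV.
  by nra.
(* Coincidences among the entries would mean b / a = s, a / c = s or b / c = s^2, all excluded by
   the size of s. *)
have inj_q : injective (q 0).
  apply: (inj3 _ _ _ _ erefl).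
  - have : b / a != s by apply: lt_s; rewrite /s; lra.
    apply: contraNneq => e; have eb : b = a * s by rewrite {1}e divfK.
    by rewrite [X in X / a]eb mulrAC mulfV // mul1r.
  - have : a / c != s by apply: lt_s; rewrite /s; lra.
    by apply: contraNneq => e; rewrite [X in X / c]e mulfK.
  - have : b / c != s * s.
      apply/eqP => e; have : b / c <= `|b / c| := ler_norm _.
      have : `|b / c| <= s by rewrite /s; lra.
      by nra.
    apply: contraNneq => e; have eb : b = s * c * s by rewrite -{1}e divfK.
    by rewrite [X in X / c]eb mulrAC mulfK.
(* As - u is the inverse of u, D1 D2 = diag(1, 1, d). *)
pose D1 := diag_mx (\row_(i < 3) [:: 1; u; d * u]`_i).
pose D2 := diag_mx (\row_(i < 3) [:: 1; - u; - u]`_i).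
(* The entries of q are central, so they can be moved past d to give diag(a, b, c d) = diag(t). *)
have eLU : L *m diag_mx t *m U = (L *m map_mx quatR (diag_mx p)) *m D1 *m D2 *m
    (map_mx quatR (diag_mx q) *m U).
  rewrite !mulmxA; congr (_ *m U); rewrite -!mulmxA; congr (L *m _).
  rewrite !map_diag_mx !mulmx_diag; congr diag_mx; apply/rowP=> i; rewrite !mxE.
  case: i => -[|[|[|//]]] i3 /=.
  - rewrite (_ : Ordinal i3 = 0) ?ta ?rmorph1 ?mul1r //; exact: val_inj.
  - rewrite (_ : Ordinal i3 = 1) ?tb; last exact: val_inj.
    rewrite (mulrA u) mulrN uu opprK mul1r -rmorphM mulrC divfK //.
  - rewrite (_ : Ordinal i3 = o2) ?dc; last exact: val_inj.
    rewrite (mulrA (d * u)) mulrN -(mulrA d) uu mulrN1 opprK.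
    by rewrite -quatR_comm mulrA -rmorphM mulKf.
have uNuN : - u * - u = -1 by rewrite mulrNN.
(* The four factors of Q g P are conjugated back by P, which preserves simplicity. *)
have sim := simple_SLH_conj sP PQ QP.
exists (P *m (L *m map_mx quatR (diag_mx p)) *m Q), (P *m D1 *m Q),
  (P *m D2 *m Q), (P *m (map_mx quatR (diag_mx q) *m U) *m Q).
split.
- apply: sim; apply: simple_lower => //.
  by rewrite !big_ord_recl big_ord0 !mxE /= mul1r mulr1 mulfV.
- by apply: sim; apply: sqrtN1_simple.
- by apply: sim; apply: sqrtN1_simple.
- apply: sim; apply: simple_upper => //.
  rewrite !big_ord_recl big_ord0 !mxE /= /c; field.
  by rewrite s0 a0 b0.
have telescope (A B : 'M[quat R]_3) :
    (P *m A *m Q) *m (P *m B *m Q) = P *m (A *m B) *m Q.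
  by rewrite !mulmxA -(mulmxA _ Q P) QP mulmx1.
rewrite !telescope -eLU -eg !mulmxA PQ mul1mx -mulmxA PQ mulmx1 //.
Qed.
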